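(* Let $N>1$ be an integer and let $n$ be a natural number. The $B$-spline $\varphi_n$ of order $n$ is an $N$-scaling function, and the right-hand side of its scaling equation $$\varphi_n(x)=\sqrt{N}\sum_{k}h_k\,\varphi_n(Nx-k)$$ is a finite sum. The filter coefficients are given by $$h_k=\frac{1}{\sqrt{N}\,N^{n}}\sum_{\alpha}\frac{(n+1)!}{\alpha_0!\,\alpha_1!\cdots\alpha_{N-1}!},$$ where: (i) if $n$ is odd, the summation is over all multi-indices $\alpha=(\alpha_0,\alpha_1,\dots,\alpha_{N-1})$ of nonnegative integers satisfying $$\alpha_0+\alpha_1+\dots+\alpha_{N-1}=n+1,\qquad \alpha_1+2\alpha_2+\dots+(N-1)\alpha_{N-1}-\frac{(N-1)(n+1)}{2}=k,$$ and the index $k$ varies from $-(N-1)(n+1)/2$ to $(N-1)(n+1)/2$; (ii) if $n$ is even, the summation is over all multi-indices $\alpha=(\alpha_0,\alpha_1,\dots,\alpha_{N-1})$ of nonnegative integers satisfying $$\alpha_0+\alpha_1+\dots+\alpha_{N-1}=n+1,\qquad \alpha_1+2\alpha_2+\dots+(N-1)\alpha_{N-1}-\frac{(N-1)n}{2}=k,$$ and the index $k$ varies from $-(N-1)n/2$ to $(N-1)(n/2+1)$.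
   Context: For an integer $N>1$, a function $\varphi\in L^2(\mathbb{R})$ is called $N$-scaling if it can be represented as $\varphi(x)=\sqrt{N}\sum_{k\in\mathbb{Z}}h_k\varphi(Nx-k)$ with $\sum_k|h_k|^2<\infty$; this relation is the scaling equation and $\{h_k\}$ is the scaling filter. $B$-splines: the $B$-spline of order $0$ is the characteristic function $\varphi_0$ of $[0,1)$. The $B$-spline of order $n$ is, up to an integer translation, the $(n+1)$-fold convolution $\varphi_0*\varphi_0*\cdots*\varphi_0$ (which is supported on $[0,n+1]$). The translation is fixed by requiring that the support of $\varphi_n$ is $[-(n+1)/2,(n+1)/2]$ if $n$ is odd and $[-n/2,\,n/2+1]$ if $n$ is even. Equivalently, with $\widehat f(\omega)=\int_{\mathbb{R}} f(x)e^{-i\omega x}\,dx$, $$\widehat{\varphi}_n(\omega)=e^{-iK\omega/2}\left(\frac{\sin(\omega/2)}{\omega/2}\right)^{n+1},$$ where $K=0$ if $n$ is odd and $K=1$ if $n$ is even. *)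

(* Defs.v *)
From HB Require Import structures.
From mathcomp Require Import all_boot all_order all_algebra finmap.
From mathcomp Require Import all_classical all_reals all_analysis.

Set Implicit Arguments.
Unset Strict Implicit.
Unset Printing Implicit Defensive.

Import Order.TTheory GRing.Theory Num.Theory.
Import numFieldNormedType.Exports.

Local Open Scope classical_set_scope.
Local Open Scope ring_scope.

Definition convolution (R : realType) (f g : R -> R) (x : R) : R :=
  \int[@lebesgue_measure R]_t (f t * g (x - t)).

Definition bspline0 (R : realType) : R -> R := \1_`[0, 1[.

(* The convolution of n.+1 copies of [bspline0]; it is supported on
   [0, n + 1]. *)
Definition bspline_conv (R : realType) (n : nat) : R -> R :=
  iter n (convolution (@bspline0 R)) (@bspline0 R).

(* Translating by the integer (n + 1) / 2 (n odd) or n / 2 (n even) moves the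
   support to [-(n + 1) / 2, (n + 1) / 2], resp. [- n / 2, n / 2 + 1]. *)
Definition bspline (R : realType) (n : nat) (x : R) : R :=
  bspline_conv n (x + (if odd n then (n.+1)./2 else n./2)%:R).

(* phi is in L^2, h is in l^2, and
     phi(x) = sqrt N * \sum_(k in Z) h k * phi (N x - k)   in L^2,
   where the series over Z converges unconditionally, i.e. along the net of
   finite subsets of Z. *)
Definition scaling_filter (R : realType) (N : nat) (phi : R -> R)
    (h : int -> R) : Prop :=
  [/\ phi \in Lfun (@lebesgue_measure R) 2%:E,
      (\esum_(k in [set: int]) (`|h k| ^+ 2)%:E < +oo)%E &
      forall e : R, 0 < e -> exists A : {fset int}, forall B : {fset int},
        (A `<=` B)%fset ->
        ('N[@lebesgue_measure R]_(2%:E)[(fun x => (phi x -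
            Num.sqrt N%:R * \sum_(k <- B) h k * phi (N%:R * x - k%:~R))%:E)]
          < e%:E)%E].

Definition scaling_function (R : realType) (N : nat) (phi : R -> R) : Prop :=
  exists h : int -> R, scaling_filter N phi h.

Definition finite_scaling_equation (R : realType) (N : nat) (phi : R -> R)
    (h : int -> R) (a b : int) : Prop :=
  (forall k : int, ~~ (a <= k <= b) -> h k = 0) /\
  (forall x : R, phi x = Num.sqrt N%:R *
     \sum_(k \in [set k : int | a <= k <= b]) h k * phi (N%:R * x - k%:~R)).

(* Multi-indices alpha = (alpha_0, ..., alpha_(N-1)) with
   alpha_0 + ... + alpha_(N-1) = n + 1; each entry is then at most n + 1,
   so that taking it in 'I_n.+2 loses nothing. The natural number c is the
   quantity subtracted from alpha_1 + 2 alpha_2 + ... in the constraint. *)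
Definition bspline_filter (R : realType) (N n c : nat) (k : int) : R :=
  (Num.sqrt N%:R * N%:R ^+ n)^-1 *
  \sum_(alpha : {ffun 'I_N -> 'I_n.+2} |
      ((\sum_(j < N) alpha j)%N == n.+1) &&
      ((\sum_(j < N) j * alpha j)%N%:Z - c%:Z == k))
    ((n.+1)`!%:R / \prod_(j < N) (alpha j)`!%:R).

(* Main.v *)
Require Import Defs.
From mathcomp Require Import all_boot all_order all_algebra finmap.
From mathcomp Require Import all_classical all_reals all_analysis.
From mathcomp Require Import measurable_realfun ring lra zify.

Import Order.TTheory GRing.Theory Num.Theory.
Local Open Scope ring_scope.

Set Implicit Arguments.
Unset Strict Implicit.
Unset Printing Implicit Defensive.
Local Open Scope classical_set_scope.

(** Let [C] be the [(n + 1)]-fold convolution of the box [bspline0] and let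
    [P = 1 + 'X + ... + 'X^(N - 1)]. The box is the sum of its [N] dilated
    translates, [bspline0 x = \sum_(i < N) bspline0 (N x - i)], which says that
    [P], acting by integer shifts, sends the box dilated by [N] to the box.
    Convolution commutes with shifts, and dilating both factors by [N] divides
    a convolution by [N]. Hence every further factor of the convolution
    multiplies the polynomial of the relation by [P] and its scalar by [1 / N],
    and by induction
      [C x = N ^- n * \sum_l (P ^+ n.+1)`_l * C (N x - l)]
    for every real [x] ([bspline_conv_two_scale]). In Fourier terms, the
    transform of [C] at [w] is its value at [w / N] times the power [n + 1] of
    [N^-1 (1 - z^N) / (1 - z)], where [z] is [exp (- i w / N)].

    The multinomial theorem turns [(P ^+ n.+1)`_l] into the sum over
    multi-indices that defines the filter ([coef_geometric_exp]), and the degree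
    [(N - 1)(n + 1)] of [P ^+ n.+1] bounds the range of [l]. Translating [C] by
    an integer [s] replaces [l] by [k = l - (N - 1) s]; the parity of [n] enters
    only through [s], which is [(n + 1) / 2] or [n / 2].

    The relation holds pointwise and has finitely many terms, so in the
    [L^2] statement the partial sums over all large enough finite sets of
    indices are equal to the function ([finite_scaling_filter]). What remains is
    that a B-spline is square integrable: it is measurable, has values in
    [[0, 1]], and vanishes off a bounded interval ([bspline_Lfun2]). *)

(** * The multinomial theorem and powers of a geometric sum *)

(** If two polynomials agree up to degree [m] with the exponential series of [a]
    and [b], their product agrees with that of [a + b]: this is the binomial
    formula divided by [k!]. *)
Lemma coefM_divided_powers {K : numFieldType} {A : comAlgType K} (m : nat)
    (p q : {poly A}) (a b : A) :
    (forall k, (k <= m)%N -> p`_k = k`!%:R^-1 *: a ^+ k) ->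
    (forall k, (k <= m)%N -> q`_k = k`!%:R^-1 *: b ^+ k) ->
  forall k, (k <= m)%N -> (p * q)`_k = k`!%:R^-1 *: (a + b) ^+ k.
Proof.
move=> hp hq k km; rewrite mulrC coefM [a + b]addrC exprDn scaler_sumr.
rewrite (reindex_inj rev_ord_inj); apply: eq_bigr => i _ /=.
rewrite subSS subKn; last by rewrite -ltnS.
have ik : (i <= k)%N by rewrite -ltnS.
rewrite hp ?hq ?(leq_trans _ km) ?leq_subr//.
rewrite -scalerAl -scalerAr !scalerA -scaler_nat scalerA.
congr (_ *: _); rewrite -(bin_fact ik) !natrM invfM.
rewrite mulrAC mulVf ?mul1r ?invfM 1?mulrC//.
by rewrite pnatr_eq0 -lt0n bin_gt0.
Qed.

Lemma coef_prod_divided_powers {K : numFieldType} {A : comAlgType K}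
    {I : finType} (m : nat) (p : I -> {poly A}) (x : I -> A) :
    (forall i k, (k <= m)%N -> (p i)`_k = k`!%:R^-1 *: x i ^+ k) ->
  forall k, (k <= m)%N -> (\prod_i p i)`_k = k`!%:R^-1 *: (\sum_i x i) ^+ k.
Proof.
move=> hp; pose P (q : {poly A}) (a : A) :=
  forall k, (k <= m)%N -> q`_k = k`!%:R^-1 *: a ^+ k.
rewrite -/(P _ _); apply: (big_ind2 P) => [k _|q1 a1 q2 a2 h1 h2|i _];
  last 2 first.
- exact: coefM_divided_powers.
- exact: hp.
- by case: k => [|k]; rewrite coefC ?expr0n//= ?fact0 ?invr1 ?scale1r// scaler0.
Qed.

(** Both sides are, up to the factor [m!], the coefficient of degree [m] in the
    product over [i] of the exponential series of [x i] truncated at degree [m].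
    Distributing that product over the sums yields one term for each
    multi-index with entries at most [m]. *)
Lemma multinomial_expansion {K : numFieldType} {A : comAlgType K}
    {I : finType} (m : nat) (x : I -> A) :
  (\sum_i x i) ^+ m =
  \sum_(alpha : {ffun I -> 'I_m.+1} | (\sum_i alpha i)%N == m)
    (m`!%:R / \prod_i (alpha i)`!%:R) *: \prod_i x i ^+ alpha i.
Proof.
pose p i : {poly A} := \poly_(k < m.+1) (k`!%:R^-1 *: x i ^+ k).
have pE i k : (k <= m)%N -> (p i)`_k = k`!%:R^-1 *: x i ^+ k.
  by move=> km; rewrite coef_poly ltnS km.
have := coef_prod_divided_powers pE (leqnn m).
rewrite /p; under eq_bigr do rewrite poly_def.
rewrite bigA_distr_bigA coef_sum => /(congr1 ( *:%R m`!%:R)).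
rewrite scalerA divff ?scale1r; last by rewrite pnatr_eq0 -lt0n fact_gt0.
move=> <-; rewrite scaler_sumr [RHS]big_mkcond; apply: eq_bigr => f _ /=.
under eq_bigr do rewrite -mul_polyC.
rewrite big_split/= prodrXr -rmorph_prod/= coefCM coefXn eq_sym.
case: eqP => _; last by rewrite mulr0 scaler0.
by rewrite mulr1 scaler_prod scalerA prodfV.
Qed.

Lemma coef_geometric_exp {K : numFieldType} (N m l : nat) :
  ((\sum_(j < N) 'X^j) ^+ m : {poly K})`_l =
  \sum_(alpha : {ffun 'I_N -> 'I_m.+1} |
      ((\sum_(j < N) alpha j)%N == m) && ((\sum_(j < N) j * alpha j)%N == l))
    (m`!%:R / \prod_(j < N) (alpha j)`!%:R).
Proof.
rewrite multinomial_expansion coef_sum big_mkcondr.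
apply: eq_bigr => alpha _ /=.
under [X in _ *: X]eq_bigr do rewrite -exprM.
rewrite prodrXr coefZ coefXn eq_sym; case: eqP => _; first by rewrite mulr1.
by rewrite mulr0.
Qed.

Lemma size_geometric_exp {K : numFieldType} (N m : nat) :
  (size ((\sum_(j < N) 'X^j) ^+ m : {poly K})%R <= (N.-1 * m).+1)%N.
Proof.
have hP : (size (\sum_(j < N) 'X^j : {poly K})%R <= N.-1.+1)%N.
  apply: (leq_trans (size_sum _ _ _)); apply/bigmax_leqP => i _.
  by rewrite size_polyXn (leq_trans (ltn_ord i)) ?leqSpred.
apply: (leq_trans (size_poly_exp_leq _ _)).
by rewrite ltnS leq_mul2r -subn1 leq_subLR add1n hP orbT.
Qed.

(** * Polynomials acting by integer shifts *)

(** The action of the polynomial with coefficients [p] on functions, where the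
    indeterminate acts as the translation [f |-> (x |-> f (x - 1))]. *)
Definition shift_comb {K : pzRingType} (p : seq K) (f : K -> K) (x : K) : K :=
  \sum_(l < size p) p`_l * f (x - l%:R).

(** Sums over a common bound make it possible to add polynomials of different
    sizes. *)
Lemma shift_comb_widen {K : pzRingType} (p : seq K) M f x : (size p <= M)%N ->
  shift_comb p f x = \sum_(l < M) p`_l * f (x - l%:R).
Proof.
move=> pM; rewrite /shift_comb.
rewrite -(big_mkord xpredT (fun l => p`_l * f (x - l%:R))).
rewrite (big_nat_widen _ _ _ _ _ pM).
rewrite -(big_mkord xpredT (fun l => p`_l * f (x - l%:R))) big_mkcond /=.
apply: eq_bigr => l _; case: ltnP => // pl.
by rewrite nth_default// mul0r.
Qed.

Lemma shift_combD {K : nzRingType} (p q : {poly K}) f x :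
  shift_comb (p + q) f x = shift_comb p f x + shift_comb q f x.
Proof.
rewrite (shift_comb_widen _ _ (size_polyD p q)).
rewrite (shift_comb_widen _ _ (leq_maxl (size p) (size q))).
rewrite (shift_comb_widen _ _ (leq_maxr (size p) (size q))).
rewrite -big_split; apply: eq_bigr => l _.
by rewrite coefD mulrDl.
Qed.

Lemma shift_comb_sum {K : nzRingType} {I : Type} (s : seq I) (p : I -> {poly K})
    f x :
  shift_comb (\sum_(i <- s) p i) f x = \sum_(i <- s) shift_comb (p i) f x.
Proof.
elim: s => [|i s IHs]; last by rewrite !big_cons shift_combD IHs.
by rewrite !big_nil /shift_comb size_poly0 big_ord0.
Qed.

Lemma shift_combXn {K : nzRingType} (i : nat) (p : {poly K}) f x :
  shift_comb ('X^i * p) f x = shift_comb p f (x - i%:R).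
Proof.
have sz : (size ('X^i * p)%R <= i + size p)%N.
  by rewrite (leq_trans (size_polyMleq _ _))// size_polyXn.
rewrite (shift_comb_widen _ _ sz) big_split_ord /= big1 ?add0r => [|l _].
  apply: eq_bigr => l _; rewrite coefXnM ltnNge leq_addr addKn.
  by rewrite natrD opprD addrA.
by rewrite coefXnM ltn_ord mul0r.
Qed.

(** The inductive step of the two-scale relation: one more convolution factor
    sums the previous relation over [N] consecutive shifts. *)
Lemma shift_comb_geometricM {K : nzRingType} (N : nat) (p : {poly K}) f x :
  shift_comb ((\sum_(i < N) 'X^i) * p) f x =
  \sum_(i < N) shift_comb p f (x - i%:R).
Proof.
rewrite mulr_suml shift_comb_sum; apply: eq_bigr => i _.
exact: shift_combXn.
Qed.

(** * Affine changes of variable for the Lebesgue measure *)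

Lemma measurable_affine {R : realType} (a b : R) :
  measurable_fun [set: R] (fun t : R => a * t + b).
Proof. by apply: measurable_funD => //; exact: measurable_funM. Qed.

(** Lebesgue measure is determined by its values on half-open intervals, and
    there the image of [a] times Lebesgue measure under [t |-> a t + b] has the
    right value. *)
Lemma lebesgue_measure_affine {R : realType} (a b : R) (a0 : 0 < a)
    (A : set (measurableTypeR R)) : measurable A ->
  pushforward (mscale (NngNum (ltW a0)) lebesgue_measure)
    ((fun t : R => a * t + b) : _ -> measurableTypeR R) A = lebesgue_measure A.
Proof.
move=> mA; apply/esym/lebesgue_measure_unique => //=.
  exact: measurable_affine.
move=> mphi _ [[x y]] _ <-.
rewrite /mscale /pushforward/=.
have -> : (fun t : R => a * t + b) @^-1` `]x, y] = `](x - b) / a, (y - b) / a].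
  apply/seteqP; split=> t /=; rewrite !in_itv/= ltr_pdivrMr// ler_pdivlMr//;
  by rewrite ltrBlDr lerBrDr [t * a]mulrC.
rewrite !lebesgue_measure_itv/= !lte_fin ltr_pM2r ?invr_gt0// ltrD2r.
case: ifP => _; last by rewrite mule0.
rewrite -!EFinB -EFinM; congr EFin.
by rewrite -mulrBl mulrCA divff ?gt_eqF// mulr1 opprB addrA subrK.
Qed.

Lemma ge0_integral_affine {R : realType} (a b : R) (f : R -> \bar R) :
  0 < a -> measurable_fun [set: R] f -> (forall x, (0 <= f x)%E) ->
  (\int[@lebesgue_measure R]_t f t =
   a%:E * \int[@lebesgue_measure R]_t f (a * t + b)%R)%E.
Proof.
move=> a0 mf f0; have mphi := measurable_affine a b.
have -> : (a%:E * \int[@lebesgue_measure R]_t f (a * t + b)%R =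
    \int[mscale (NngNum (ltW a0)) lebesgue_measure]_t f (a * t + b)%R)%E.
  by rewrite ge0_integral_mscale//; exact: measurableT_comp mf mphi.
have := @ge0_integral_pushforward _ _ (measurableTypeR R)
  (measurableTypeR R) R _ mphi
  (mscale (NngNum (ltW a0)) lebesgue_measure) setT f measurableT mf
  (fun y _ => f0 y).
rewrite preimage_setT => <-.
by apply: eq_measure_integral => //= A mA _; exact/esym/lebesgue_measure_affine.
Qed.

(** * Convolution with the unit box *)

Lemma bspline0E {R : realType} (x : R) : bspline0 x = (0 <= x < 1)%R%:R.
Proof. by rewrite /bspline0 indicE mem_setE in_itv. Qed.

Lemma measurable_bspline0 {R : realType} :
  measurable_fun [set: R] (@bspline0 R).
Proof. exact: measurable_indic. Qed.

(** The hypotheses on [f] are those that convolution with the box preserves, so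
    that they carry over to B-splines by induction on the order. *)
Section unit_box_convolution.
Context {R : realType} (f : R -> R).
Hypotheses (mf : measurable_fun [set: R] f) (f01 : forall x, 0 <= f x <= 1).

Let measurable_integrand (x : R) :
  measurable_fun [set: R] (fun t => bspline0 t * f (x - t)).
Proof.
apply: measurable_funM; first exact: measurable_bspline0.
apply: measurableT_comp => //; exact: measurable_funB.
Qed.

Let integrand_bounds x t : 0 <= bspline0 t * f (x - t) <= bspline0 t.
Proof.
rewrite bspline0E; case: (0 <= t < 1)%R; last by rewrite mul0r lexx.
by rewrite mul1r.
Qed.

Let integrable_bspline0 :
  (@lebesgue_measure R).-integrable setT (EFin \o @bspline0 R).
Proof.
exact: integrable_indic_itv.
Qed.

Lemma integrable_bspline0_mul x :
  (@lebesgue_measure R).-integrable setT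
    (fun t => (bspline0 t * f (x - t))%:E).
Proof.
apply: le_integrable integrable_bspline0 => //.
  by apply/measurable_EFinP; exact: measurable_integrand.
move=> t _ /=; have /andP[h0 h1] := integrand_bounds x t.
by rewrite lee_fin !ger0_norm// (le_trans h0).
Qed.

Lemma convolution_bspline0_bounds x : 0 <= convolution (@bspline0 R) f x <= 1.
Proof.
apply/andP; split.
  by apply: Rintegral_ge0 => t _; have /andP[] := integrand_bounds x t.
have -> : 1 = \int[@lebesgue_measure R]_t bspline0 t :> R.
  rewrite /Rintegral /bspline0 integral_indic//= setIT.
  by rewrite lebesgue_measure_itv/= lte01 oppr0 adde0.
apply: le_Rintegral => //; first exact: integrable_bspline0_mul.
by move=> t _; have /andP[] := integrand_bounds x t.
Qed.

(** The integrand is measurable and nonnegative as a function of two variables,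
    so that Tonelli's theorem gives measurability of the partial integral. *)
Lemma measurable_convolution_bspline0 :
  measurable_fun [set: R] (convolution (@bspline0 R) f).
Proof.
have mF := @measurable_fun_fubini_tonelli_F _ _ (measurableTypeR R)
  (measurableTypeR R) R lebesgue_measure
  (fun z : R * R => (bspline0 z.2 * f (z.1 - z.2))%:E).
apply: (@measurableT_comp _ _ _ _ _ _ fine) => //; apply: mF.
- apply/measurable_EFinP; apply: measurable_funM.
    exact: measurableT_comp measurable_bspline0 measurable_snd.
  apply: measurableT_comp => //; exact: measurable_funB.
- by move=> z; rewrite lee_fin; have /andP[] := integrand_bounds z.1 z.2.
Qed.

End unit_box_convolution.

(** * The two-scale relation *)

(** The translates of [[0, 1[] by [0, ..., M - 1] tile [[0, M[]. The tiling is
    exact because the intervals are half-open, which is why the scaling equation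
    of order 0 holds at every point. *)
Lemma sum_bspline0_shift {R : realType} (M : nat) (y : R) :
  \sum_(i < M) bspline0 (y - i%:R) = (0 <= y < M%:R)%R%:R.
Proof.
elim: M => [|M IHM].
  by rewrite big_ord0; case: leP => //= y0; rewrite ltNge y0.
rewrite big_ord_recr /= IHM bspline0E subr_ge0 ltrBlDl -natr1.
have : 0 <= M%:R :> R by [].
by case: (leP 0 y) => ?; case: (leP M%:R y) => ?; case: (ltP y (M%:R + 1)) => ?
  //=; lra.
Qed.

Lemma bspline0_two_scale {R : realType} (N : nat) (x : R) : (0 < N)%N ->
  bspline0 x = \sum_(i < N) bspline0 (N%:R * x - i%:R).
Proof.
move=> N0; rewrite sum_bspline0_shift bspline0E.
have N0' : 0 < N%:R :> R by rewrite ltr0n.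
by rewrite pmulr_rge0// -{2}(mulr1 N%:R) ltr_pM2l.
Qed.

Section dilation.
Context {R : realType} (f : R -> R).
Hypotheses (mf : measurable_fun [set: R] f) (f01 : forall x, 0 <= f x <= 1).

(** Convolution is linear and commutes with translations. *)
Lemma convolution_bspline0_shift_comb (c : R) (p : seq R) (x : R) :
  convolution (@bspline0 R) (fun z => c * shift_comb p f z) x =
  c * shift_comb p (convolution (@bspline0 R) f) x.
Proof.
have int l : (@lebesgue_measure R).-integrable setT
    (fun t => (bspline0 t * f (x - l%:R - t))%:E).
  exact: integrable_bspline0_mul.
rewrite /convolution /shift_comb.
under eq_Rintegral => t _.
  rewrite mulrCA mulr_sumr.
  under eq_bigr => l _ do rewrite mulrCA addrAC.
  over.
have intp (l : 'I_(size p)) : (@lebesgue_measure R).-integrable setT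
    (fun t => (p`_l * (bspline0 t * f (x - l%:R - t)))%:E).
  exact: (integrableZl measurableT p`_l (int l)).
rewrite RintegralZl//; last first.
  rewrite (_ : _ \o _ = (fun t => \sum_(l < size p)
      (p`_l * (bspline0 t * f (x - l%:R - t)))%:E)%E); last first.
    by apply/funext => t /=; rewrite sumEFin.
  exact: integrable_sum.
congr (c * _); rewrite /Rintegral.
under eq_integral => t _ do rewrite -sumEFin.
rewrite integral_sum//.
rewrite -sum_fine => [|l _]; last exact: integrable_fin_num.
by apply: eq_bigr => l _; have := RintegralZl p`_l measurableT (int l).
Qed.

(** Split the box into its [N] dilated translates and substitute
    [u = N t - i] in the [i]-th integral. *)
Lemma convolution_bspline0_dilate (N : nat) (x : R) : (0 < N)%N ->
  convolution (@bspline0 R) f x = N%:R^-1 *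
  \sum_(i < N) convolution (@bspline0 R) (fun z => f (N%:R^-1 * z))
    (N%:R * x - i%:R).
Proof.
move=> N0; have N0' : 0 < N%:R :> R by rewrite ltr0n.
pose g (i : nat) u := bspline0 u * f (N%:R^-1 * (N%:R * x - i%:R - u)).
have mg i : measurable_fun [set: R] (g i).
  apply: measurable_funM; first exact: measurable_bspline0.
  apply: (measurableT_comp mf); apply: measurable_funM => //.
  exact: measurable_funB.
have g0 i u : 0 <= g i u.
  rewrite /g bspline0E mulr_ge0//.
  by have /andP[] := f01 (N%:R^-1 * (N%:R * x - i%:R - u)).
have gE i t : g i (N%:R * t + - i%:R) = bspline0 (N%:R * t - i%:R) * f (x - t).
  congr (_ * f _); rewrite opprD addrACA opprK addNr addr0 -mulrBr mulrA.
  by rewrite mulVf ?mul1r ?gt_eqF.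
rewrite /convolution /Rintegral.
under eq_integral => t _.
  rewrite (bspline0_two_scale _ N0) mulr_suml -sumEFin.
  under eq_bigr => i _ do rewrite -gE.
  over.
rewrite ge0_integral_sum//; last 2 first.
- move=> i; apply/measurable_EFinP.
  exact: (measurableT_comp (mg i) (measurable_affine _ _)).
- by move=> i t _; rewrite lee_fin.
have intg i : (@lebesgue_measure R).-integrable setT (EFin \o g i).
  apply: (integrable_bspline0_mul (f := fun z => f (N%:R^-1 * z))) => //.
  by apply: (measurableT_comp mf); exact: measurable_funM.
have step (i : 'I_N) :
    (\int[@lebesgue_measure R]_t (g i (N%:R * t + - i%:R))%:E =
     N%:R^-1%:E * \int[@lebesgue_measure R]_t (g i t)%:E)%E.
  have mgi : measurable_fun [set: R] (EFin \o g i) by exact/measurable_EFinP.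
  have := ge0_integral_affine (- i%:R) N0' mgi.
  move=> /(_ (fun u => g0 i u)) /= ->; rewrite muleA -EFinM mulVf ?mul1e//.
  by rewrite gt_eqF.
under eq_bigr => i _ do rewrite step.
rewrite -sum_fine => [|i _]; last first.
  by rewrite fin_numM//; have := integrable_fin_num measurableT (intg i).
rewrite mulr_sumr; apply: eq_bigr => i _.
by rewrite fineM//; have := integrable_fin_num measurableT (intg i).
Qed.

End dilation.

(** Both properties go through the induction together: the measurability of the
    next convolution uses the sign of the integrand, and its bounds use
    integrability. *)
Lemma bspline_conv_measurable_bounded {R : realType} (n : nat) :
  measurable_fun [set: R] (@bspline_conv R n) /\
  forall x : R, 0 <= bspline_conv n x <= 1.
Proof.
elim: n => [|n [mn n01]].
  split=> [|x]; first exact: measurable_bspline0.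
  by rewrite /= bspline0E; case: (0 <= x < 1)%R; rewrite ?lexx ?ler01.
split; first exact: measurable_convolution_bspline0.
exact: convolution_bspline0_bounds.
Qed.

Lemma bspline_conv_support {R : realType} (n : nat) (x : R) :
  ~~ (0 <= x <= n.+1%:R) -> bspline_conv n x = 0.
Proof.
elim: n x => [|n IHn] x hx.
  rewrite /= bspline0E; case: (boolP (0 <= x < 1)%R) => // /andP[x0 /ltW x1].
  by rewrite x0 x1 in hx.
rewrite /= /convolution -/(bspline_conv n) /Rintegral integral0_eq// => t _.
rewrite bspline0E; have [/andP[t0 t1]|] := boolP (0 <= t < 1)%R; last first.
  by rewrite mul0r.
rewrite IHn ?mulr0//; apply: contra hx => /andP[]; rewrite -!natr1 => h1 h2.
by apply/andP; split; lra.
Qed.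

Lemma bspline_conv_two_scale {R : realType} (N n : nat) (x : R) : (0 < N)%N ->
  bspline_conv n x = N%:R ^- n *
    shift_comb ((\sum_(i < N) 'X^i) ^+ n.+1 : {poly R}) (bspline_conv n)
      (N%:R * x).
Proof.
move=> N0; elim: n x => [|n IHn] x.
  rewrite expr0 invr1 mul1r -[_ ^+ 1]mulr1 shift_comb_geometricM /=.
  rewrite (bspline0_two_scale _ N0); apply: eq_bigr => i _.
  by rewrite /shift_comb size_poly1 big_ord1 coefC mul1r subr0.
have [mn n01] := @bspline_conv_measurable_bounded R n.
rewrite [LHS]/= -/(bspline_conv n) (convolution_bspline0_dilate mn n01 _ N0).
rewrite [_ ^+ n.+2]exprS shift_comb_geometricM [N%:R ^+ n.+1]exprS invfM -mulrA.
congr (_ * _); rewrite mulr_sumr; apply: eq_bigr => i _.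
rewrite -convolution_bspline0_shift_comb//.
congr convolution; apply/funext => z.
by rewrite IHn mulrA mulfV ?mul1r// pnatr_eq0 -lt0n.
Qed.

(** * Finite scaling equations *)

Lemma finite_int_interval (a b : int) : finite_set [set k : int | a <= k <= b].
Proof.
apply: (sub_finite_set _ (finite_image (fun l : nat => a + l%:Z)
  (finite_II `|b - a|.+1))) => k /= /andP[ak kb].
by exists `|k - a|%N; rewrite /=; lia.
Qed.

(** Every finite set of indices that contains [[a, b]] gives a partial sum equal
    to [phi] everywhere, so the error is the zero function. *)
Lemma finite_scaling_filter {R : realType} (N : nat) (phi : R -> R)
    (h : int -> R) (a b : int) : phi \in Lfun (@lebesgue_measure R) 2%:E ->
  finite_scaling_equation N phi h a b -> scaling_filter N phi h.
Proof.
move=> phi2 [h0 phiE]; have finab := finite_int_interval a b; split=> //.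
- rewrite (esumID [set k : int | a <= k <= b]) => [|k _]; last first.
    by rewrite lee_fin exprn_ge0.
  rewrite [X in (_ + X)%E]esum1 => [|k /= [_ /negP/h0 ->]]; last first.
    by rewrite normr0 expr0n.
  rewrite adde0 setTI esum_fset//.
  by rewrite fsumEFin// ltry.
- move=> e e0; exists (fset_set [set k : int | a <= k <= b]) => B AB.
  rewrite [ltLHS](_ : _ = 0%E) ?lte_fin//.
  rewrite -[RHS](@Lnorm0 _ _ _ (@lebesgue_measure R) 2%:E)//.
  apply: eq_Lnorm => x /=; congr EFin.
  apply/eqP; rewrite subr_eq0 phiE; apply/eqP.
  congr (_ * _); rewrite fsbig_finite//=.
  apply: big_fset_incl => // k _; rewrite in_fset_set// mem_setE /= => /h0 ->.
  by rewrite mul0r.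
Qed.

(** * B-splines and their filters *)

(** The square of a B-spline is at most the indicator function of a bounded
    interval that contains its support. *)
Lemma bspline_Lfun2 {R : realType} (n : nat) :
  @bspline R n \in Lfun (@lebesgue_measure R) 2%:E.
Proof.
have [mn n01] := @bspline_conv_measurable_bounded R n.
set s := (if odd n then (n.+1)./2 else n./2)%:R : R.
have mb : measurable_fun [set: R] (@bspline R n).
  by apply: (measurableT_comp mn); exact: measurable_funD.
rewrite inE/=; apply/andP; split; first by rewrite inE.
rewrite inE/= /finite_norm unlock; apply: poweR_lty.
apply: (@le_lt_trans _ _
  (\int[@lebesgue_measure R]_x (\1_`[- s, n.+1%:R - s] x)%:E)%E); last first.
  rewrite integral_indic//= setIT lebesgue_measure_itv/=.
  by case: ifP => _; rewrite ?ltry.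
apply: ge0_le_integral => //=.
- apply/measurable_EFinP.
  apply: (@measurableT_comp _ _ _ _ _ _ (fun y : R => y `^ 2)) => //.
  exact: measurableT_comp.
- exact/measurable_EFinP.
move=> x _; rewrite lee_fin.
have /andP[b0 b1] : 0 <= bspline n x <= 1 by exact: n01.
rewrite ger0_norm// powR_mulrn// indicE mem_setE in_itv/=.
have [xs|xs] := boolP (_ && _).
  by rewrite exprn_ile1.
rewrite /bspline -/s bspline_conv_support ?expr0n//.
by apply: contra xs => /andP[h1 h2]; apply/andP; split; lra.
Qed.

Lemma bspline_filter_coef {R : realType} (N n c l : nat) :
  bspline_filter R N n c (l%:Z - c%:Z) =
  (Num.sqrt N%:R * N%:R ^+ n)^-1 * ((\sum_(j < N) 'X^j) ^+ n.+1 : {poly R})`_l.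
Proof.
rewrite coef_geometric_exp; congr (_ * _); apply: eq_bigl => alpha.
by congr (_ && _); rewrite (inj_eq (addIr _)) eqz_nat.
Qed.

Lemma bspline_filter_lt {R : realType} (N n c : nat) (k : int) :
  k < - c%:Z -> bspline_filter R N n c k = 0.
Proof.
move=> kc; rewrite /bspline_filter big_pred0 ?mulr0// => alpha.
apply/negbTE/negP => /andP[_ /eqP kE]; move: kc.
by rewrite -kE ltNge lerBrDr addNr.
Qed.

Lemma fsbig_int_interval {R : nmodType} (c m : nat) (F : int -> R) :
  \sum_(k \in [set k : int | - c%:Z <= k <= m%:Z - c%:Z]) F k =
  \sum_(l < m.+1) F (l%:Z - c%:Z).
Proof.
pose r : seq int := [seq l%:Z - c%:Z | l <- iota 0 m.+1].
have rE (k : int) : (k \in r) = (- c%:Z <= k <= m%:Z - c%:Z).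
  apply/mapP/idP => [[l]|kcm]; first by rewrite mem_iota => lm ->; lia.
  by exists (absz (k + c%:Z)); [rewrite mem_iota|]; lia.
have setE : [set k : int | - c%:Z <= k <= m%:Z - c%:Z] = [set` r].
  by apply/seteqP; split=> k /=; rewrite rE.
have ur : uniq r by rewrite map_inj_uniq ?iota_uniq// => i j; lia.
rewrite -(big_mkord xpredT (fun l => F (l%:Z - c%:Z))) /index_iota subn0.
rewrite -(big_map (fun l : nat => l%:Z - c%:Z) xpredT F) -/r.
rewrite setE -fsbig_seq//.
Qed.

(** Since [N (x + s) - l = (N x - k) + s] for [k = l - (N - 1) s], a translation
    by [s] only shifts the indices of the two-scale relation. *)
Lemma bspline_conv_finite_scaling {R : realType} (N n s : nat)
    (hN : (0 < N)%N) :
  finite_scaling_equation N (fun x : R => bspline_conv n (x + s%:R))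
    (bspline_filter R N n (N.-1 * s)) (- (N.-1 * s)%N%:Z)
    ((N.-1 * n.+1)%N%:Z - (N.-1 * s)%N%:Z).
Proof.
set c := (N.-1 * s)%N; set m := (N.-1 * n.+1)%N; split=> [k|x].
  have [kc|ck] := ltP k (- c%:Z); first by rewrite bspline_filter_lt.
  have -> : k = (absz (k + c%:Z))%:Z - c%:Z.
    by rewrite gez0_abs ?addrK// -lerBlDr sub0r.
  move: (absz _) => l ml; have {}ml : (m < l)%N by lia.
  rewrite bspline_filter_coef nth_default ?mulr0//.
  exact: leq_trans (size_geometric_exp _ _) ml.
rewrite fsbig_int_interval.
rewrite (bspline_conv_two_scale n _ hN).
rewrite (shift_comb_widen _ _ (size_geometric_exp _ _)) !mulr_sumr.
apply: eq_bigr => l _; rewrite bspline_filter_coef invfM !mulrA.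
congr (_ * _ * _).
  by rewrite mulfV ?mul1r// sqrtr_eq0 -ltNge ltr0n.
congr (bspline_conv _ _).
have Ns : N%:R * s%:R = c%:R + s%:R :> R.
  by rewrite -natrM -natrD /c -mulSnr prednK.
by rewrite rmorphB/= mulrDr Ns opprB; ring.
Qed.

Lemma bspline_scaling {R : realType} (N n c : nat) (b : int) :
  (0 < N)%N ->
  let s := if odd n then (n.+1)./2 else n./2 in
  c = (N.-1 * s)%N -> b = (N.-1 * n.+1)%N%:Z - c%:Z ->
  scaling_filter N (@bspline R n) (@bspline_filter R N n c) /\
  finite_scaling_equation N (@bspline R n) (@bspline_filter R N n c) (- c%:Z) b.
Proof.
move=> N0 s -> ->; have H := @bspline_conv_finite_scaling R N n s N0.
by split=> //; exact: finite_scaling_filter (bspline_Lfun2 n) H.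
Qed.

Theorem theorem2 (R : realType) (N n : nat) (hN : (1 < N)%N) :
  [/\ scaling_function N (@bspline R n),
      (odd n ->
        let c := (N.-1 * n.+1)./2 in
        scaling_filter N (@bspline R n) (@bspline_filter R N n c) /\
        finite_scaling_equation N (@bspline R n) (@bspline_filter R N n c)
          (- c%:Z) c%:Z) &
      (~~ odd n ->
        let c := (N.-1 * n)./2 in
        scaling_filter N (@bspline R n) (@bspline_filter R N n c) /\
        finite_scaling_equation N (@bspline R n) (@bspline_filter R N n c)
          (- c%:Z) (N.-1 * (n./2).+1)%N%:Z)].
Proof.
have N0 : (0 < N)%N := ltnW hN.
split=> [|nodd c|neven c].
- have [h _] := @bspline_scaling R N n _ _ N0 erefl erefl.
  by exists (bspline_filter R N n (N.-1 * (if odd n then (n.+1)./2 else n./2))).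
- have e : (N.-1 * n.+1)%N = (N.-1 * (n.+1)./2).*2.
    by rewrite doubleMr -[in LHS](odd_double_half n.+1)/= nodd.
  by apply: bspline_scaling; rewrite ?nodd// /c e doubleK//; lia.
- have e : (N.-1 * n)%N = (N.-1 * n./2).*2.
    by rewrite doubleMr -[in LHS](odd_double_half n) (negPf neven).
  apply: bspline_scaling; rewrite ?(negPf neven) ?/c ?e ?doubleK//.
  by rewrite !mulnS e; lia.
Qed.
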